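(* Let $S=\langle p_1,\dots,p_N\rangle\leq\mathcal{P}_N$ be a subgroup of the Pauli group generated by $N$ independent and pairwise commuting Pauli product matrices $p_1,\dots,p_N$, such that $-\mathrm{Id}_{2^N}\notin S$. Then the Gibbs variety of the real linear span of $p_1,\dots,p_N$ is an independence model on $N$ binary random variables after a linear change of coordinates.
   Context: Let $\sigma_X=\begin{pmatrix}0&1\\1&0\end{pmatrix}$, $\sigma_Y=\begin{pmatrix}0&-i\\i&0\end{pmatrix}$, $\sigma_Z=\begin{pmatrix}1&0\\0&-1\end{pmatrix}$, and let $\mathcal{P}_1=\{\pm\mathrm{Id}_2,\pm i\,\mathrm{Id}_2,\pm\sigma_X,\pm i\sigma_X,\pm\sigma_Y,\pm i\sigma_Y,\pm\sigma_Z,\pm i\sigma_Z\}$. The Pauli group $\mathcal{P}_N$ is the set of all $N$-fold tensor products of elements of $\mathcal{P}_1$ (as $2^N\times 2^N$ matrices), with matrix multiplication; its elements are called Pauli product matrices. Generators $p_1,\dots,p_N$ of $S$ are independent if for every $i$ the subgroup generated by all $p_j$ with $j\neq i$ is a proper subgroup of $S$. For a real linear space $\mathcal{L}$ of $n\times n$ matrices, the Gibbs variety $\mathrm{GV}(\mathcal{L})$ is the Zariski closure of $\exp(\mathcal{L})=\{\exp(L)\mid L\in\mathcal{L}\}$ in the affine space $\mathbb{C}^{n\times n}$ ($\exp$ is the matrix exponential). The independence model on $N$ binary random variables is taken here in the following affine form. Let $A$ be the $N\times 2^N$ matrix whose columns $a^{(1)},\dots,a^{(2^N)}$ are all vectors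 in $\{-1,1\}^N$, and let $X_A\subseteq\mathbb{C}^{2^N}$ be the Zariski closure of the image of $(\mathbb{C}^* )^N\to\mathbb{C}^{2^N}$, $t\mapsto(t^{a^{(1)}},\dots,t^{a^{(2^N)}})$. The statement ''a variety in $\mathbb{C}^{2^N\times 2^N}$ is an independence model after a linear change of coordinates'' means that there is an invertible linear map $\mathbb{C}^{2^N\times 2^N}\to\mathbb{C}^{2^N\times 2^N}$ carrying it onto $\{\mathrm{diag}(x)\mid x\in X_A\}$. *)

(* Defs.v *)
From HB Require Import structures.
From mathcomp Require Import all_boot all_order all_algebra.
From mathcomp Require Import complex mxtens.
From mathcomp Require mpoly.
From mathcomp Require Import all_classical all_reals all_analysis.

Set Implicit Arguments.
Unset Strict Implicit.
Unset Printing Implicit Defensive.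

Import Order.TTheory GRing.Theory Num.Theory.
Import numFieldNormedType.Exports.
Local Open Scope classical_set_scope.
Local Open Scope ring_scope.
Local Open Scope complex_scope.

Section Pauli.
Variable R : realType.
Local Notation C := R[i].

Definition mx2 (a b c d : C) : 'M[C]_2 :=
  \matrix_(i, j) if i == 0 then (if j == 0 then a else b)
                 else (if j == 0 then c else d).

Definition sigmaX : 'M[C]_2 := mx2 0 1 1 0.
Definition sigmaY : 'M[C]_2 := mx2 0 (- 'i%C) 'i%C 0.
Definition sigmaZ : 'M[C]_2 := mx2 1 0 0 (-1).

Definition pauli1 : set 'M[C]_2 :=
  [set a *: s | a in [set 1; -1; 'i%C; - 'i%C]
              & s in [set 1%:M; sigmaX; sigmaY; sigmaZ]].

(* f 0 (x) ... (x) f (N - 1); the cast is needed because 2 ^ N.+1 is not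
   convertible to 2 * 2 ^ N for open N. *)
Fixpoint tensor_prod (N : nat) : ('I_N -> 'M[C]_2) -> 'M[C]_(2 ^ N) :=
  if N is N'.+1 return ('I_N -> 'M[C]_2) -> 'M[C]_(2 ^ N) then
    fun f => castmx (esym (expnS 2 N'), esym (expnS 2 N'))
               (tensmx (f ord0) (tensor_prod (fun i => f (lift ord0 i))))
  else fun=> 1%:M.

Definition pauli_group {N : nat} : set 'M[C]_(2 ^ N) :=
  [set tensor_prod f | f in [set f | forall i, pauli1 (f i)]].

Definition pauli_subgroup (N : nat) (H : set 'M[C]_(2 ^ N)) : Prop :=
  [/\ H `<=` pauli_group, H 1%:M,
      forall x y, H x -> H y -> H (x *m y) & forall x, H x -> H (invmx x)].

Definition pauli_generated (N : nat) : set 'M[C]_(2 ^ N) -> set 'M[C]_(2 ^ N) :=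
  smallest (@pauli_subgroup N).

Definition pauli_independent (N : nat) (p : 'I_N -> 'M[C]_(2 ^ N)) : Prop :=
  forall i, pauli_generated [set p j | j in [set j | j != i]]
            `<` pauli_generated (range p).

End Pauli.

Section Gibbs.
Variable R : realType.
Local Notation C := R[i].

(* R[i]^o carries the topology of the complex modulus. *)
Definition mexp (n : nat) (A : 'M[C]_n) : 'M[C]_n :=
  lim (series (fun k => (k`!%:R^-1 *: A ^+ k) : 'M[C^o]_n) @ \oo).

Definition real_span (I : finType) (n : nat) (p : I -> 'M[C]_n) :
    set 'M[C]_n :=
  [set \sum_i (c i)%:C *: p i | c in [set: I -> R]].

Definition zero_locus (m : nat) (I : set (mpoly.mpoly m C)) : set 'rV[C]_m :=
  [set x | forall f, I f -> mpoly.meval (fun i => x 0 i) f = 0].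

Definition zariski_closed (m : nat) (X : set 'rV[C]_m) : Prop :=
  exists I, X = zero_locus I.

Definition zariski_closure (m : nat) : set 'rV[C]_m -> set 'rV[C]_m :=
  smallest (@zariski_closed m).

(* C^(n x n) is the affine space of dimension n * n via the row-major bijection
   mxvec. *)
Definition zariski_closure_mx (n : nat) (X : set 'M[C]_n) : set 'M[C]_n :=
  mxvec @^-1` zariski_closure (mxvec @` X).

Definition gibbs_variety (n : nat) (L : set 'M[C]_n) : set 'M[C]_n :=
  zariski_closure_mx (@mexp n @` L).

(* As A has 2 ^ N columns, every sign vector is then a column exactly once; the
   order of the columns is left free. *)
Definition all_sign_columns (N : nat) (A : 'M[int]_(N, 2 ^ N)) : Prop :=
  range (fun k => col k A) =
  [set v : 'cV[int]_N | forall i, v i 0 = 1 \/ v i 0 = -1].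

Definition torus (N : nat) : set 'rV[C]_N := [set t | forall i, t 0 i != 0].

Definition monomial_map (N m : nat) (A : 'M[int]_(N, m)) (t : 'rV[C]_N) :
    'rV[C]_m :=
  \row_k \prod_i t 0 i ^ A i k.

Definition independence_model (N : nat) (A : 'M[int]_(N, 2 ^ N)) :
    set 'rV[C]_(2 ^ N) :=
  zariski_closure (monomial_map A @` @torus N).

End Gibbs.

Arguments independence_model R {N} A.

(* Main.v *)
Require Import Defs.
From HB Require Import structures.
From mathcomp Require Import all_boot all_order all_algebra.
From mathcomp Require Import complex mxtens.
From mathcomp Require mpoly.
Import (canonicals) mpoly.
From mathcomp Require Import all_classical all_reals all_analysis.
From mathcomp Require Import ring.

Set Implicit Arguments.
Unset Strict Implicit.
Unset Printing Implicit Defensive.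

Import Order.TTheory GRing.Theory Num.Theory.
Import numFieldNormedType.Exports.
Local Open Scope classical_set_scope.
Local Open Scope ring_scope.

(** The matrices p_i are commuting involutions that can be diagonalized
    simultaneously, and every sign vector occurs exactly once as a joint
    eigenvalue.  In a joint eigenbasis the exponential of the real combination
    with coefficients c is the diagonal matrix whose entries are the monomials
    t^a, a a sign vector, at the positive point t = (exp c_1, ..., exp c_N);
    conjugation by the base change is therefore the required linear map, up to
    taking Zariski closures.

    That every sign vector s occurs is the place where independence and the
    absence of -1 enter.  An element of a Pauli group squares to 1 or -1 and
    has trace 0 unless it is scalar; in a subgroup without -1 it thus squares
    to 1, and has trace 0 unless it is the identity
    ([pauli_subgroup_sqr], [pauli_subgroup_tr0]).  Independence says that a
    product of the p_i over a nonempty set of indices is not the identity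
    ([subprod_neq1]), so only the empty product contributes to the trace of
    prod_i (1 + s_i p_i), which is 2^N ([mxtrace_stabilizer_prod]).  This
    matrix is then nonzero, and any nonzero row of it is a joint eigenvector
    with eigenvalues s ([stabilizer_eigenvector]).  As there are 2^N sign
    vectors in dimension 2^N, these rows form an eigenbasis
    ([stabilizer_diagonalizable]).

    Two facts on Zariski closures finish the proof.  Closures are transported
    by linear maps, in particular between a space of diagonal matrices and the
    space of their diagonals ([zariski_closure_mx_diag]).  And a polynomial
    that vanishes at the monomial images of all positive real points vanishes
    on the image of the whole torus: with all coordinates but one fixed it is a
    Laurent polynomial in the remaining one, which has infinitely many zeros
    ([meval_torus_eq0], [independence_modelE]). *)

(** * Squares and traces in the Pauli group *)

Lemma tens_scalar_mxM (S : comPzRingType) m n (a b : S) :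
  a%:M *t b%:M = (a * b)%:M :> 'M[S]_(m * n).
Proof.
apply/matrixP => k l.
case: (mxtens_indexP k) => i j; case: (mxtens_indexP l) => i' j'.
rewrite tensmxE !mxE (can_eq (@mxtens_indexK m n)) xpair_eqE.
by do 2!case: eqP => _; rewrite ?mulr1n ?mulr0n ?mulr0 ?mul0r.
Qed.

Lemma mxtrace_tens (S : comPzRingType) m n (A : 'M[S]_m) (B : 'M[S]_n) :
  \tr (A *t B) = \tr A * \tr B.
Proof.
rewrite /mxtrace mulr_sum; apply: eq_bigr => k _.
by case: (mxtens_indexP k) => i j; rewrite tensmxE mxtens_indexK.
Qed.

Section PauliTensors.
Local Open Scope complex_scope.
Variable R : realType.
Local Notation C := R[i].

Lemma eq_tensor_prod N (f g : 'I_N -> 'M[C]_2) :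
  f =1 g -> tensor_prod f = tensor_prod g.
Proof. by move=> fg; congr tensor_prod; apply/funext. Qed.

Lemma tensor_prodM N (f g : 'I_N -> 'M[C]_2) :
  tensor_prod f *m tensor_prod g = tensor_prod (fun i => f i *m g i).
Proof.
elim: N f g => [|N IH] f g /=; first by rewrite mulmx1.
by rewrite -IH -tensmx_mul; case: _ / (esym _).
Qed.

Lemma tensor_prod_scalar N (c : 'I_N -> C) :
  tensor_prod (fun i => (c i)%:M) = (\prod_i c i)%:M.
Proof.
elim: N c => [|N IH] c /=; first by rewrite big_ord0.
by rewrite IH big_ord_recl tens_scalar_mxM; case: _ / (esym _).
Qed.

Lemma mxtrace_tensor_prod N (f : 'I_N -> 'M[C]_2) :
  \tr (tensor_prod f) = \prod_i \tr (f i).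
Proof.
elim: N f => [|N IH] f /=; first by rewrite big_ord0 mxtrace1.
by rewrite big_ord_recl -IH -mxtrace_tens; case: _ / (esym _).
Qed.

Lemma sigma_sqr (s : 'M[C]_2) :
  [set 1%:M; sigmaX R; sigmaY R; sigmaZ R] s -> s *m s = 1%:M.
Proof.
have ii : 'i%C * 'i%C = -1 :> C by rewrite -expr2 sqr_i.
move=> [[[->|->]|->]|->]; first exact: mulmx1.
all: apply/matrixP => i j; rewrite !mxE !big_ord_recl big_ord0 !mxE.
all: case: i j => [[|[|i]] hi] [[|[|j]] hj] //=.
all: by rewrite ?(mulrN, mulNr, ii, mulr0, mul0r, mulr1, add0r) ?opprK
  ?oppr0 ?addr0.
Qed.

Lemma pauli1_sqr (x : 'M[C]_2) :
  pauli1 x -> exists2 c : C, c ^+ 2 = 1 & x *m x = c%:M.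
Proof.
move=> [a aP [s /sigma_sqr ss <-]]; exists (a ^+ 2); last first.
  by rewrite -scalemxAl -scalemxAr ss scalerA scale_scalar_mx mulr1.
by case: aP => [[[->|->]|->]|->]; rewrite ?sqrrN ?sqr_i ?sqrrN !expr1n.
Qed.

Lemma pauli1_tr0 (x : 'M[C]_2) : pauli1 x -> \tr x != 0 -> exists c, x = c%:M.
Proof.
move=> [a aP [s sP <-]].
case: sP => [[[->|->]|->]|->]; first by exists a; rewrite scale_scalar_mx mulr1.
all: rewrite /mxtrace !big_ord_recl big_ord0 !mxE /=.
all: by rewrite ?mulr0 ?mulr1 ?mulrN1 ?addr0 ?subrr ?eqxx.
Qed.

Lemma pauli_sqr N (x : 'M[C]_(2 ^ N)) :
  pauli_group x -> exists2 c : C, c ^+ 2 = 1 & x *m x = c%:M.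
Proof.
move=> [f /= fP <-].
have /choice[c cP] i : exists c : C, c ^+ 2 = 1 /\ f i *m f i = c%:M.
  by have [c] := pauli1_sqr (fP i); exists c.
exists (\prod_i c i).
  by rewrite -prodrXl big1// => i _; case: (cP i).
rewrite tensor_prodM -tensor_prod_scalar; apply: eq_tensor_prod => i.
by case: (cP i).
Qed.

(** The trace is multiplicative on tensor products and the three sigma matrices
    are traceless, so a nonzero trace forces every tensor factor to be scalar.
    *)
Lemma pauli_tr0 N (x : 'M[C]_(2 ^ N)) :
  pauli_group x -> \tr x != 0 -> exists c, x = c%:M.
Proof.
move=> [f /= fP <-]; rewrite mxtrace_tensor_prod => /prodf_neq0 trf.
have /choice[c cP] i : exists c, f i = c%:M by apply: pauli1_tr0 (fP i) (trf i _).
by exists (\prod_i c i); rewrite -tensor_prod_scalar; apply: eq_tensor_prod.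
Qed.

Lemma pauli_subgroup_sqr N (H : set 'M[C]_(2 ^ N)) (x : 'M[C]_(2 ^ N)) :
  pauli_subgroup H -> ~ H (- 1%:M) -> H x -> x *m x = 1%:M.
Proof.
move=> [HP _ HM _] HN1 Hx; have [c /eqP] := pauli_sqr (HP _ Hx).
rewrite sqrf_eq1 => /orP[/eqP-> //|/eqP-> xx].
have N1 : - 1%:M = (-1)%:M :> 'M[C]_(2 ^ N) by rewrite raddfN.
by case: HN1; rewrite N1 -xx; apply: HM.
Qed.

(** A nonzero trace makes x a scalar, and by the previous lemma one of square
    1; the only such scalar in H is the identity. *)
Lemma pauli_subgroup_tr0 N (H : set 'M[C]_(2 ^ N)) (x : 'M[C]_(2 ^ N)) :
  pauli_subgroup H -> ~ H (- 1%:M) -> H x -> x <> 1%:M -> \tr x = 0.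
Proof.
move=> HS HN1 Hx x1; have xx := pauli_subgroup_sqr HS HN1 Hx.
have [HP _ _ _] := HS.
apply: contra_notP x1 => /eqP/(pauli_tr0 (HP _ Hx))[c xc].
have : 1%:M = (c ^+ 2)%:M :> 'M[C]_(2 ^ N).
  by rewrite -xx xc -scalar_mxM.
move=> /(congr1 mxtrace); rewrite !mxtrace_scalar -[in RHS]mulr_natr -[LHS]mul1r.
have n0 : (2 ^ N)%:R != 0 :> C by rewrite pnatr_eq0 expn_eq0.
move=> /(mulIf n0)/esym/eqP; rewrite sqrf_eq1 => /orP[/eqP<- //|/eqP cN].
have N1 : - 1%:M = (-1)%:M :> 'M[C]_(2 ^ N) by rewrite raddfN.
by case: HN1; rewrite N1 -cN -xc.
Qed.

End PauliTensors.

(** * Joint eigenvectors of independent commuting Pauli products *)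

(** The noncommutative replacement for splitting one factor off a big product.
    *)
Lemma comm_prodD1 (S : pzRingType) (I : eqType) (s : seq I) (x : I -> S) i :
  uniq s -> i \in s -> (forall j, GRing.comm (x i) (x j)) ->
  \prod_(j <- s) x j = x i * \prod_(j <- s | j != i) x j.
Proof.
move=> + + xC; elim: s => // k s IH /= /andP[ks us]; rewrite inE !big_cons.
have [ik _|ik /= si] := eqVneq i k; first subst k.
  congr (_ * _); rewrite [RHS]big_seq_cond big_seq.
  by apply: eq_bigl => j; case: eqVneq => [->|_]; rewrite ?(negPf ks) ?andbT.
by rewrite IH // mulrA -xC -mulrA.
Qed.

Section Stabilizer.
Variables (R : realType) (N : nat).
Local Notation C := R[i].
Local Notation M := 'M[C]_(2 ^ N).
Variables (p : 'I_N -> M) (H : set M).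
Hypotheses (p_indep : pauli_independent p)
           (p_comm : forall i j, p i *m p j = p j *m p i)
           (HS : pauli_subgroup H) (HN1 : ~ H (- 1%:M)) (pH : forall i, H (p i)).

Lemma stabilizer_sqr i : p i * p i = 1.
Proof. exact: pauli_subgroup_sqr HS HN1 (pH i). Qed.

Definition subprod (f : 'I_N -> bool) : M :=
  \prod_i (if f i then p i else 1).

Lemma subgroup_prod (K : set M) (P : pred 'I_N) (x : 'I_N -> M) :
  pauli_subgroup K -> (forall i, P i -> K (x i)) -> K (\prod_(i | P i) x i).
Proof. by move=> [_ K1 KM _] xK; apply: (big_ind K). Qed.

(** If the product were the identity, the involution p_i would equal the
    product of the other selected generators, so the remaining generators would
    generate everything. *)
Lemma subprod_neq1 (f : 'I_N -> bool) i : f i -> subprod f <> 1.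
Proof.
move=> fi f1; have [_ []] := p_indep i.
move=> x px K [KS pK]; apply: px; split=> // _ [j _ <-].
have [->|ji] := eqVneq j i; last by apply: pK; exists j.
suff -> : p i = \prod_(k | k != i) (if f k then p k else 1).
  apply: subgroup_prod => // k ki; case: ifP => _; first by apply: pK; exists k.
  by case: KS.
rewrite -[LHS]mulr1 -[X in _ * X]f1 /subprod.
rewrite (comm_prodD1 (i := i)) ?index_enum_uniq ?mem_index_enum ?fi //.
  by rewrite mulrA stabilizer_sqr mul1r.
by move=> k; case: ifP => _; [exact: p_comm | exact: commr1].
Qed.

(** Expanding the product gives scalar multiples of the 2^N partial products of
    the p_i; all of them are traceless except the empty one. *)
Lemma mxtrace_stabilizer_prod (s : 'I_N -> C) :
  \tr (\prod_i (1 + s i *: p i)) = (2 ^ N)%:R.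
Proof.
have -> : \prod_i (1 + s i *: p i) =
    \prod_i \sum_(b : bool) (if b then s i *: p i else 1).
  by apply: eq_bigr => i _; rewrite big_bool addrC.
rewrite bigA_distr_bigA raddf_sum /=.
rewrite (bigD1 [ffun=> false]) //= big1 ?mxtrace1; last first.
  by move=> i _; rewrite ffunE.
rewrite big1 ?addr0 // => f f0.
have [i fi] : exists i, f i.
  apply/existsP; apply: contraNT f0; rewrite negb_exists => /forallP f0.
  by apply/eqP/ffunP => i; rewrite ffunE; apply/negbTE.
have [c ->] : exists c, \prod_i (if f i then s i *: p i else 1) = c *: subprod f.
  apply: (big_ind2 (fun X Y : M => exists c : C, X = c *: Y)).
  - by exists 1; rewrite scale1r.
  - move=> _ X _ Y [c ->] [d ->]; exists (c * d).
    by rewrite -[LHS]scalemxAl -scalemxAr scalerA.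
  - by move=> j _; case: ifP => _; [exists (s j)|exists 1; rewrite scale1r].
have Hf : H (subprod f).
  by apply: subgroup_prod => // j _; case: ifP => // _; case: HS.
rewrite mxtraceZ (pauli_subgroup_tr0 HS HN1 Hf) ?mulr0 //.
exact: subprod_neq1 fi.
Qed.

Lemma eigenrow_prod (u : 'rV[C]_(2 ^ N)) (c s : 'I_N -> C) :
  (forall i, u *m p i = c i *: u) ->
  u *m (\prod_i (1 + s i *: p i)) = (\prod_i (1 + s i * c i)) *: u.
Proof.
move=> up; apply: (big_ind2 (fun (X : M) a => u *m X = a *: u)).
- by rewrite mulmx1 scale1r.
- by move=> X a Y b uX uY; rewrite mulmxA uX -scalemxAl uY scalerA.
- by move=> i _; rewrite mulmxDr mulmx1 -scalemxAr up scalerA scalerDl scale1r.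
Qed.

(** The product F of the factors 1 + s_i p_i is, up to a scalar, the projector
    on the joint eigenspace: p_i F = s_i F, and F commutes with p_i. It is
    nonzero because its trace is. *)
Lemma stabilizer_eigenvector (s : 'I_N -> C) : (forall i, s i ^+ 2 = 1) ->
  exists2 u : 'rV[C]_(2 ^ N), u != 0 & forall i, u *m p i = s i *: u.
Proof.
move=> s1; pose F : M := \prod_i (1 + s i *: p i).
have /matrix0Pn[k [l Fkl]] : F != 0.
  apply/eqP => F0; have := mxtrace_stabilizer_prod s; rewrite -/F F0 mxtrace0.
  by move/esym/eqP; rewrite pnatr_eq0 expn_eq0.
have pC i j : GRing.comm (p i) (1 + s j *: p j).
  apply: commrD; first exact: commr1.
  by rewrite /GRing.comm -[LHS]scalemxAr -[RHS]scalemxAl p_comm.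
exists (row k F); first by apply: contraNneq Fkl => /rowP/(_ l); rewrite !mxE => ->.
move=> i; rewrite -row_mul -linearZ /=; congr row.
have -> : F *m p i = p i * F by apply/esym/commr_prod => j _; exact: pC.
rewrite /F (comm_prodD1 (i := i)) ?index_enum_uniq ?mem_index_enum //; last first.
  move=> j; apply/commr_sym/commrD; first exact: commr1.
  apply: commr_sym; rewrite /GRing.comm -[LHS]scalemxAl -[RHS]scalemxAr.
  by congr (_ *: _); exact: pC.
rewrite mulrA [RHS]scalemxAl; congr (_ * _).
rewrite mulrDr mulr1 -[X in _ + X]scalemxAr [X in _ *: X]stabilizer_sqr.
by rewrite scalerDr scalerA -expr2 s1 scale1r addrC.
Qed.

(** The rows of U are joint eigenvectors u_k for the 2^N distinct sign vectors
    s_k. They are independent because the product of the factors 1 + s_k(i) p_i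
    kills every u_j with j != k and multiplies u_k by a power of 2. *)
Lemma stabilizer_diagonalizable (s : 'I_(2 ^ N) -> 'I_N -> C) :
  injective s -> (forall k i, s k i ^+ 2 = 1) ->
  exists2 U : M, U \in unitmx
    & forall i, U *m p i = diag_mx (\row_k s k i) *m U.
Proof.
move=> s_inj s1.
have /choice[u uP] k : exists u : 'rV[C]_(2 ^ N),
    u != 0 /\ forall i, u *m p i = s k i *: u.
  by have [u] := stabilizer_eigenvector (s1 k); exists u.
pose U : M := \matrix_k u k.
exists U; last first.
  move=> i; apply/row_matrixP => k; rewrite row_mul rowK (uP k).2 mul_diag_mx.
  by apply/rowP => l; rewrite !mxE.
rewrite -row_free_unit -kermx_eq0; apply/rowV0P => w /sub_kermxP wU.
apply/rowP => k; rewrite mxE; apply/eqP.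
have : w *m U *m (\prod_i (1 + s k i *: p i)) = 0 by rewrite wU mul0mx.
rewrite (mulmx_sum_row w) mulmx_suml (bigD1 k) //= => /eqP.
rewrite [X in _ + X]big1 => [|j jk]; last first.
  rewrite rowK -scalemxAl (eigenrow_prod _ (uP j).2).
  have [i ski] : exists i, s k i != s j i.
    apply/existsP; apply: contraNT jk; rewrite negb_exists => /forallP sE.
    rewrite -(inj_eq s_inj); apply/eqP/funext => i; apply/eqP.
    by rewrite eq_sym; move: (sE i); rewrite negbK.
  rewrite (bigD1 i) //=.
  (* two distinct numbers of square 1 are opposite *)
  have /eqP : s k i ^+ 2 = s j i ^+ 2 by rewrite !s1.
  rewrite eqf_sqr (negPf ski) /= => /eqP ->.
  by rewrite mulNr -expr2 s1 subrr mul0r scale0r scaler0.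
rewrite addr0 rowK -scalemxAl (eigenrow_prod _ (uP k).2) scalerA.
rewrite scaler_eq0 (negPf (uP k).1) orbF mulf_eq0 => /orP[//|].
rewrite prodf_seq_eq0 => /hasP[i _ /=].
by rewrite -expr2 s1 -mulr2n pnatr_eq0.
Qed.

End Stabilizer.

(** * Exponential of a diagonalizable matrix *)

Section MatrixExponential.
Local Open Scope complex_scope.
Variable R : realType.
Local Notation C := R[i].

Lemma cvg_real_complex (u : nat -> R) (l : R) :
  u @ \oo --> l -> (fun k => (u k)%:C : C^o) @ \oo --> (l%:C : C^o).
Proof.
move=> ul; apply/cvgrPdist_lt => e e0.
have [re e_re] : exists re : R, e = re%:C by apply/complex_realP/gtr0_real.
rewrite e_re ltcR in e0.
near=> k; rewrite -rmorphB /= normc_def /= expr0n /= addr0 sqrtr_sqr e_re ltcR.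
by near: k; move/cvgrPdist_lt : ul; apply.
Unshelve. all: by end_near. Qed.

Lemma cvg_mx (T : topologicalType) m n (u : nat -> 'M[T]_(m, n))
    (M : 'M[T]_(m, n)) :
  (forall i j, (fun k => u k i j) @ \oo --> M i j) -> u @ \oo --> M.
Proof.
move=> uM A [P MP PA].
have : \forall k \near \oo, forall i j, P i j (u k i j).
  by apply: filter_forall => i; apply: filter_forall => j; exact: uM.
by apply: filterS => k Pk; exact: PA.
Qed.

Lemma lim_mx m n (u : nat -> 'M[C^o]_(m, n)) (M : 'M[C^o]_(m, n)) :
  (forall i j, (fun k => u k i j) @ \oo --> M i j) -> lim (u @ \oo) = M.
Proof. by move=> /cvg_mx/cvg_lim; apply; exact: norm_hausdorff. Qed.

Lemma diag_conj_exp (S : comPzRingType) n (L U : 'M[S]_n) (d : 'rV[S]_n) k :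
  U *m L = diag_mx d *m U ->
  U *m (L ^+ k) = diag_mx (\row_j d 0 j ^+ k) *m U.
Proof.
move=> UL; elim: k => [|k IH].
  rewrite mulmx1 (_ : \row__ _ = const_mx 1) ?diag_const_mx ?mul1mx //.
  by apply/rowP => j; rewrite !mxE.
rewrite exprSr mulmxA IH -mulmxA UL mulmxA mulmx_diag; congr (diag_mx _ *m _).
by apply/rowP => j; rewrite !mxE exprSr.
Qed.

(** Each entry of a partial sum of the matrix exponential is a fixed linear
    combination of partial sums of the scalar exponentials exp(d_l), so the
    limit can be taken entrywise. *)
Lemma mexp_diag n (L U : 'M[C]_n) (d : 'I_n -> R) :
  U \in unitmx -> U *m L = diag_mx (\row_k (d k)%:C) *m U ->
  U *m mexp L *m invmx U = diag_mx (\row_k (expR (d k))%:C).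
Proof.
move=> Uunit UL; set D := diag_mx _.
suff -> : mexp L = invmx U *m D *m U.
  by rewrite !mulmxA mulmxV // mul1mx -mulmxA mulmxV // mulmx1.
apply: lim_mx => i j; rewrite -mulmxA mxE.
have -> : (fun k => series (fun k => (k`!%:R^-1 *: L ^+ k) : 'M[C^o]_n) k i j) =
  (fun k => \sum_l invmx U i l * ((series (exp_coeff (d l)) k)%:C * U l j) : C^o).
  apply/funext => k; rewrite seriesEnat summxE.
  under [RHS]eq_bigr do rewrite seriesEnat rmorph_sum mulr_suml mulr_sumr.
  rewrite exchange_big /=; apply: eq_bigr => m _.
  have -> : L ^+ m = invmx U *m (diag_mx (\row_l (d l)%:C ^+ m) *m U).
    rewrite -[LHS]mul1mx -(mulVmx Uunit) -mulmxA (diag_conj_exp m UL).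
    by congr (_ *m (diag_mx _ *m _)); apply/rowP => l; rewrite !mxE.
  rewrite !mxE mulr_sumr; apply: eq_bigr => l _.
  rewrite mul_diag_mx !mxE /exp_coeff /= rmorphM rmorphXn fmorphV rmorph_nat.
  ring.
apply: cvg_big => [|l _].
  exact: add_continuous.
rewrite mul_diag_mx !mxE; apply: cvgM; first exact: cvg_cst.
apply: cvgM; last exact: cvg_cst.
exact/cvg_real_complex/is_cvg_series_exp_coeff.
Qed.

End MatrixExponential.

(** * Zariski closures and linear maps *)

Section ZariskiClosure.
Variable R : realType.
Local Notation C := R[i].

(** The zero locus of any set of polynomials vanishing on X is closed and
    contains X, and the locus of a single such polynomial already tests
    membership. *)
Lemma zariski_closureP m (X : set 'rV[C]_m) (x : 'rV[C]_m) :
  zariski_closure X x <->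
  forall f : mpoly.mpoly m C,
    (forall y, X y -> mpoly.meval (fun i => y 0 i) f = 0) ->
    mpoly.meval (fun i => x 0 i) f = 0.
Proof.
split=> [Xx f fX|Xx _ [[I ->] XI] f If].
  apply: (Xx (zero_locus [set f])); last by [].
  by split=> [|y Xy _ ->]; [exists [set f] | exact: fX].
by apply: Xx => y /XI; apply.
Qed.

Lemma sub_zariski_closure m (X Y : set 'rV[C]_m) :
  X `<=` Y -> zariski_closure X `<=` zariski_closure Y.
Proof.
move=> XY x /zariski_closureP Xx; apply/zariski_closureP => f fY.
by apply: Xx => y /XY; exact: fY.
Qed.

Definition mpoly_of_linear m n (g : 'rV[C]_m -> 'rV[C]_n) i :
    mpoly.mpoly m C :=
  \sum_j g (delta_mx 0 j) 0 i *: mpoly.mpolyX C (mpoly.mnm1 j).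

Lemma meval_mpoly_of_linear m n (g : {linear 'rV[C]_m -> 'rV[C]_n}) i
    (y : 'rV[C]_m) :
  mpoly.meval (fun j => y 0 j) (mpoly_of_linear g i) = g y 0 i.
Proof.
rewrite [in RHS](row_sum_delta y) (linear_sum g) summxE raddf_sum /=.
by apply: eq_bigr => j _; rewrite mpoly.mevalZ mpoly.mevalXU linearZ mxE mulrC.
Qed.

Lemma zariski_closure_linear_eq0 m n (g : {linear 'rV[C]_m -> 'rV[C]_n}) i
    (X : set 'rV[C]_m) x :
  (forall y, X y -> g y 0 i = 0) -> zariski_closure X x -> g x 0 i = 0.
Proof.
move=> gX /zariski_closureP Xx; rewrite -meval_mpoly_of_linear; apply: Xx => y.
by rewrite meval_mpoly_of_linear; exact: gX.
Qed.

(** Polynomials pull back to polynomials along linear maps. *)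
Lemma zariski_closure_linear m n (g : {linear 'rV[C]_m -> 'rV[C]_n})
    (X : set 'rV[C]_m) x :
  zariski_closure X x -> zariski_closure (g @` X) (g x).
Proof.
move=> /zariski_closureP Xx; apply/zariski_closureP => f fgX.
pose q := [tuple mpoly_of_linear g i | i < n].
have qE (y : 'rV[C]_m) : mpoly.meval (fun i => y 0 i) (mpoly.comp_mpoly q f) =
                         mpoly.meval (fun i => g y 0 i) f.
  rewrite mpoly.comp_mpoly_meval; apply: mpoly.meval_eq => i.
  by rewrite tnth_mktuple meval_mpoly_of_linear.
by rewrite -qE; apply: Xx => y Xy; rewrite qE; apply: fgX; exists y.
Qed.

End ZariskiClosure.

Section DiagonalPart.
Variables (S : pzRingType) (n : nat).

Definition diag_part (X : 'M[S]_n) : 'rV[S]_n := \row_k X k k.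


Fact diag_part_is_linear : linear diag_part.
Proof. by move=> a X Y; apply/rowP => k; rewrite !mxE. Qed.

HB.instance Definition _ :=
  GRing.isLinear.Build S 'M[S]_n 'rV[S]_n *:%R diag_part diag_part_is_linear.

Lemma diag_partK (X : 'M[S]_n) :
  (forall i j, i != j -> X i j = 0) -> diag_mx (diag_part X) = X.
Proof.
move=> X0; apply/matrixP => i j; rewrite !mxE.
by case: eqVneq => [->|/X0 ->]; rewrite ?mulr1n ?mulr0n.
Qed.

Lemma diag_mxK (x : 'rV[S]_n) : diag_part (diag_mx x) = x.
Proof. by apply/rowP => k; rewrite !mxE eqxx. Qed.

End DiagonalPart.

Arguments diag_part {S n} X.

(** Vanishing of the off-diagonal entries is a linear condition, hence survives
    in the closure; the diagonals themselves are transported back and forth by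
    linear maps. *)
Lemma zariski_closure_mx_diag (R : realType) n (X : set 'M[R[i]]_n)
    (D : set 'rV[R[i]]_n) (phi psi : {linear 'M[R[i]]_n -> 'M[R[i]]_n}) :
  cancel phi psi -> cancel psi phi -> phi @` X = diag_mx @` D ->
  phi @` zariski_closure_mx X = diag_mx @` zariski_closure D.
Proof.
move=> phiK psiK phiX.
have phi_diag Y : X Y -> exists2 d, D d & phi Y = diag_mx d.
  move=> XY; have : (phi @` X) (phi Y) by exists Y.
  by rewrite phiX => -[d Dd <-]; exists d.
apply/seteqP; split => [_ [Y XY <-]|_ [d Dd <-]].
  exists (diag_part (phi Y)); last first.
    apply: diag_partK => i j ij; rewrite -[Y]mxvecK -(mxvecE (phi _)).
    apply: (zariski_closure_linear_eq0 (g := mxvec \o phi \o vec_mx) _ XY).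
    move=> _ [Z /phi_diag[d _ Zd] <-] /=; rewrite mxvecK mxvecE Zd !mxE.
    by rewrite (negPf ij).
  have := zariski_closure_linear (g := diag_part \o phi \o vec_mx) XY.
  rewrite /= mxvecK; apply: sub_zariski_closure.
  move=> _ [_ [Z /phi_diag[d Dd Zd] <-] <-] /=.
  by rewrite mxvecK Zd diag_mxK.
exists (psi (diag_mx d)); last exact: psiK.
have := zariski_closure_linear (g := mxvec \o psi \o diag_mx) Dd.
apply: sub_zariski_closure => _ [e De <-] /=.
have [Y XY Ye] : (phi @` X) (diag_mx e) by rewrite phiX; exists e.
by exists Y; rewrite // -Ye phiK.
Qed.

(** * Density of the positive points of the torus *)

Lemma expRM_int (R : realType) (a : int) (x : R) : expR (a%:~R * x) = expR x ^ a.
Proof.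
by case: a => n; rewrite ?NegzE ?mulrNz ?mulNr ?expRN expRM_natl.
Qed.

Section LaurentDensity.
Local Open Scope complex_scope.
Variable R : realType.
Local Notation C := R[i].

(** Restriction to nonzero arguments of a Laurent polynomial, after clearing
    the denominator z^M. *)
Definition laurent (h : C -> C) := exists M (q : {poly C}),
  forall z, z != 0 -> z ^+ M * h z = q.[z].

Lemma laurent_cst c : laurent (fun=> c).
Proof. by exists 0%N, c%:P => z _; rewrite hornerC mul1r. Qed.

Lemma laurent_exprz (a : int) : laurent (fun z => z ^ a).
Proof.
case: a => n.
  by exists 0%N, ('X^n) => z _; rewrite hornerXn mul1r.
by exists n.+1, 1 => z z0; rewrite NegzE hornerC mulfV // expf_neq0.
Qed.

Lemma laurentD h k : laurent h -> laurent k -> laurent (fun z => h z + k z).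
Proof.
move=> [M [q hq]] [L [r kr]]; exists (M + L)%N, ('X^L * q + 'X^M * r) => z z0.
by rewrite !hornerE -hq // -kr // exprD; ring.
Qed.

Lemma laurentM h k : laurent h -> laurent k -> laurent (fun z => h z * k z).
Proof.
move=> [M [q hq]] [L [r kr]]; exists (M + L)%N, (q * r) => z z0.
by rewrite hornerM -hq // -kr // exprD; ring.
Qed.

Lemma laurent_sum (I : Type) (s : seq I) (h : I -> C -> C) :
  (forall i, laurent (h i)) -> laurent (fun z => \sum_(i <- s) h i z).
Proof.
move=> hL; elim: s => [|i s IH].
  by under eq_fun do rewrite big_nil; exact: laurent_cst.
by under eq_fun do rewrite big_cons; exact: laurentD.
Qed.

Lemma laurent_prod (I : Type) (s : seq I) (h : I -> C -> C) :
  (forall i, laurent (h i)) -> laurent (fun z => \prod_(i <- s) h i z).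
Proof.
move=> hL; elim: s => [|i s IH].
  by under eq_fun do rewrite big_nil; exact: laurent_cst.
by under eq_fun do rewrite big_cons; exact: laurentM.
Qed.

Lemma laurentX h n : laurent h -> laurent (fun z => h z ^+ n).
Proof.
move=> hL; elim: n => [|n IH]; first exact: laurent_cst.
by under eq_fun do rewrite exprS; exact: laurentM.
Qed.

Lemma laurent_meval m (f : mpoly.mpoly m C) (v : 'I_m -> C -> C) :
  (forall i, laurent (v i)) -> laurent (fun z => mpoly.meval (v^~ z) f).
Proof.
move=> vL; under eq_fun do rewrite mpoly.mevalE.
apply: laurent_sum => a; apply: laurentM; first exact: laurent_cst.
by apply: laurent_prod => i; exact: laurentX.
Qed.

(** After clearing denominators, the positive integers are infinitely many
    roots of a polynomial. *)
Lemma laurent_eq0 h : laurent h ->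
  (forall x : R, 0 < x -> h x%:C = 0) -> forall z, z != 0 -> h z = 0.
Proof.
move=> [M [q hq]] h0 z z0.
suff q0 : q = 0.
  by apply: (mulfI (expf_neq0 M z0)); rewrite hq // q0 horner0 mulr0.
apply/eqP; apply: contraT => q0.
(* one root more than the degree allows *)
pose s := [seq i.+1%:R : C | i <- iota 0 (size q)].
have : (size s < size q)%N.
  apply: max_poly_roots => //; last first.
    rewrite map_inj_uniq ?iota_uniq // => i j /eqP.
    by rewrite eqr_nat => /eqP[].
  apply/allP => _ /mapP[i _ ->]; rewrite /root -hq ?pnatr_eq0 //.
  have -> : i.+1%:R = (i.+1%:R : R)%:C by rewrite rmorph_nat.
  by rewrite h0 ?mulr0.
by rewrite size_map size_iota ltnn.
Qed.

Definition positive_torus {N : nat} : set 'rV[C]_N :=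
  [set t | forall i, exists2 x : R, 0 < x & t 0 i = x%:C].

(** The coordinates of a torus point are released from being positive one at a
    time: s lists those that are already arbitrary, and each step is an
    instance of [laurent_eq0] in a single coordinate. *)
Lemma meval_torus_eq0 N m (A : 'M[int]_(N, m)) (f : mpoly.mpoly m C) :
  (forall t, positive_torus t ->
     mpoly.meval (fun k => monomial_map A t 0 k) f = 0) ->
  forall t, torus t -> mpoly.meval (fun k => monomial_map A t 0 k) f = 0.
Proof.
move=> fpos.
suff gen (s : seq 'I_N) : forall t, torus t ->
    (forall i, i \notin s -> exists2 x : R, 0 < x & t 0 i = x%:C) ->
    mpoly.meval (fun k => monomial_map A t 0 k) f = 0.
  by move=> t t0; apply: (gen (enum 'I_N)) => // i; rewrite mem_enum.
elim: s => [|j s IH] t t0 ts; first by apply: fpos => i; exact: ts.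
pose t' z : 'rV[C]_N := \row_i if i == j then z else t 0 i.
have t'E : t' (t 0 j) = t by apply/rowP => i; rewrite mxE; case: eqP => // ->.
pose h z := mpoly.meval (fun k => monomial_map A (t' z) 0 k) f.
rewrite -t'E; apply: (@laurent_eq0 h _ _ (t 0 j)); last exact: t0.
  apply: (@laurent_meval _ _ (fun k z => _)) => k.
  under eq_fun do rewrite mxE.
  apply: (@laurent_prod _ _ (fun i z => _)) => i.
  under eq_fun do rewrite mxE.
  by case: eqP => _; [exact: laurent_exprz | exact: laurent_cst].
move=> x x0; apply: IH => [i|i si].
  rewrite mxE; have [_|_] := eqVneq i j; last exact: t0.
  by rewrite -(rmorph0 (real_complex R)) (inj_eq (@complexI R)) gt_eqF.
rewrite mxE; have [_|ij] := eqVneq i j; first by exists x.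
by apply: ts; rewrite inE negb_or ij.
Qed.

(** The positive points of the torus are the exponentials of real vectors. *)
Lemma independence_modelE N (A : 'M[int]_(N, 2 ^ N)) :
  independence_model R A =
  zariski_closure [set \row_k (expR (\sum_i c i * (A i k)%:~R))%:C
                  | c in [set: 'I_N -> R]].
Proof.
apply/seteqP; split=> x /zariski_closureP fx; apply/zariski_closureP => f f0.
  apply: fx => _ [t tt <-]; apply: meval_torus_eq0 tt => {}t tpos.
  apply: f0; have /choice[y yP] i : exists y : R, 0 < y /\ t 0 i = y%:C.
    by have [y] := tpos i; exists y.
  exists (fun i => ln (y i)) => //; apply/rowP => k; rewrite !mxE expR_sum.
  rewrite rmorph_prod; apply: eq_bigr => i _; have [y0 ->] := yP i.
  by rewrite mulrC expRM_int lnK // fmorphXz.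
apply: fx => _ [c _ <-]; apply: f0; exists (\row_i (expR (c i))%:C).
  move=> i; rewrite mxE -(rmorph0 (real_complex R)) (inj_eq (@complexI R)).
  by rewrite gt_eqF ?expR_gt0.
apply/rowP => k; rewrite !mxE expR_sum rmorph_prod; apply: eq_bigr => i _.
by rewrite mxE mulrC expRM_int fmorphXz.
Qed.

End LaurentDensity.

(** * The Gibbs variety *)

(** All 2^N sign vectors occur among 2^N columns, so no column is repeated. *)
Lemma sign_columns_inj N (A : 'M[int]_(N, 2 ^ N)) :
  all_sign_columns A -> injective (fun k => A^~ k).
Proof.
move=> A_sign.
have /choice[g gP] (f : {ffun 'I_N -> bool}) :
    exists k, forall i, A i k = if f i then 1 else -1.
  have : range (fun k => col k A) (\col_i if f i then 1 else -1).
    by rewrite A_sign => i; rewrite mxE; case: ifP; [left|right].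
  by move=> [k _ /colP kE]; exists k => i; have := kE i; rewrite !mxE.
have g_inj : injective g.
  move=> f f' gff'; apply/ffunP => i; have := gP f i.
  by rewrite gff' gP; do 2!case: (_ i).
have card_le : (#|'I_(2 ^ N)| <= #|{ffun 'I_N -> bool}|)%N.
  by rewrite card_ffun card_bool !card_ord.
have [h hK gK] := inj_card_bij g_inj card_le.
move=> k k' kk'; rewrite -(gK k) -(gK k'); congr g.
apply/ffunP => i; have /(congr1 (@^~ i)) := kk'.
by rewrite -{1}(gK k) -{1}(gK k') !gP; do 2!case: (h _ i).
Qed.

Lemma sign_entry N (A : 'M[int]_(N, 2 ^ N)) :
  all_sign_columns A -> forall i k, A i k = 1 \/ A i k = -1.
Proof.
move=> A_sign i k; have : range (fun k => col k A) (col k A) by exists k.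
by rewrite A_sign => /(_ i); rewrite mxE.
Qed.

Theorem theoremA2 (R : realType) (N : nat) (p : 'I_N -> 'M[R[i]]_(2 ^ N))
    (p_pauli : forall i, pauli_group (p i))
    (p_indep : pauli_independent p)
    (p_comm : forall i j, p i *m p j = p j *m p i)
    (p_neg1 : ~ pauli_generated (range p) (- 1%:M))
    (A : 'M[int]_(N, 2 ^ N)) (A_sign : all_sign_columns A) :
  exists2 phi : {linear 'M[R[i]]_(2 ^ N) -> 'M[R[i]]_(2 ^ N)},
    bijective phi &
    phi @` gibbs_variety (real_span p)
    = [set diag_mx x | x in independence_model R A].
Proof.
(* since -1 is not generated, some Pauli subgroup contains the p_i but not -1 *)
have [H [HS pH] HN1] : exists2 H,
    pauli_subgroup H /\ range p `<=` H & ~ H (- 1%:M).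
  apply: contrapT => noH; apply: p_neg1 => H HP.
  by apply: contrapT => HN1; apply: noH; exists H.
have [||U Uunit Up] := stabilizer_diagonalizable p_indep p_comm HS HN1
    (fun i => pH _ (ex_intro2 _ _ i I erefl)) (s := fun k i => (A i k)%:~R).
- move=> k k' kk'; apply: (sign_columns_inj A_sign); apply/funext => i.
  by have /(congr1 (@^~ i))/intr_inj := kk'.
- move=> k i; have [->|->] := sign_entry A_sign i k;
    by rewrite ?rmorphN ?rmorph1 ?sqrrN expr1n.
pose phi : {linear 'M[R[i]]_(2 ^ N) -> 'M[R[i]]_(2 ^ N)} :=
  mulmxr (invmx U) \o mulmx U.
pose psi : {linear 'M[R[i]]_(2 ^ N) -> 'M[R[i]]_(2 ^ N)} :=
  mulmxr U \o mulmx (invmx U).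
have phiK : cancel phi psi.
  by move=> X; rewrite /= !mulmxA mulVmx // mul1mx mulmxKV.
have psiK : cancel psi phi.
  by move=> X; rewrite /= !mulmxA mulmxV // mul1mx mulmxK.
have phi_exp (c : 'I_N -> R) : phi (mexp (\sum_i (c i)%:C%C *: p i)) =
    diag_mx (\row_k (expR (\sum_i c i * (A i k)%:~R))%:C%C).
  apply: mexp_diag => //; rewrite mulmx_sumr.
  under eq_bigr => i _ do rewrite -scalemxAr Up scalemxAl.
  rewrite -mulmx_suml; congr (_ *m _); apply/matrixP => k l.
  rewrite summxE !mxE rmorph_sum -sumrMnl; apply: eq_bigr => i _.
  by rewrite !mxE mulrnAr rmorphM rmorph_int.
exists phi; first by exists psi.
rewrite independence_modelE; apply: zariski_closure_mx_diag phiK psiK _.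
apply/seteqP; split => [_ [_ [_ [c _ <-] <-] <-]|_ [_ [c _ <-] <-]].
  by rewrite phi_exp; eexists; [exists c|].
rewrite -phi_exp; exists (mexp (\sum_i (c i)%:C%C *: p i)) => //.
by exists (\sum_i (c i)%:C%C *: p i) => //; exists c.
Qed.
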